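(* If a set $L$ of (finite and infinite) trees can be characterized by an $\mathrm{HCTL}$-formula (i.e. there is an $\mathrm{HCTL}$ state formula $\varphi$ such that for every tree $T$: $T\in L$ iff $T\models\varphi$), then the spoiler has a winning strategy in the $\mathrm{HCTL}$-game for $L$.
   Context: Trees are rooted, possibly infinite, edges directed from parent to child, nodes labelled with sets of propositions; a path from $v$ is a maximal downward sequence of nodes starting at $v$. $\mathrm{HCTL}=\bigcup_k \mathrm{HCTL}_k$, where $\mathrm{HCTL}_k$ has state formulas $\varphi ::= p \mid \neg\varphi \mid \varphi\lor\varphi \mid \varphi\land\varphi \mid \mathsf{E}\mathsf X\varphi\mid\mathsf A\mathsf X\varphi \mid \mathsf{E}(\varphi\mathsf U\varphi)\mid\mathsf A(\varphi\mathsf U\varphi) \mid {\downarrow}x_i\,\varphi \mid x_i \mid @_{x_i}\varphi \mid \mathit{root} \mid @_{\mathit{root}}\varphi$ ($1\le i\le k$), evaluated at a tree, a node $v$ and an assignment $\vec u=(u_1,\dots,u_k)$ of nodes to $x_1,\dots,x_k$: $\mathsf E\mathsf X\varphi$/$\mathsf A\mathsf X\varphi$: some/every child satisfies $\varphi$; $\mathsf E(\varphi_1\mathsf U\varphi_2)$/$\mathsf A(\varphi_1\mathsf U\varphi_2)$: some/every path $v=v_0,v_1,\dots$ from $v$ has $j$ with $\varphi_2$ at $v_j$ and $\varphi_1$ at $v_l$ for $l<j$; ${\downarrow}x_i\varphi$: $\varphi$ holds at $v$ with $u_i$ replaced by $v$; $x_i$: $v=u_i$; $@_{x_i}\varphi$: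 $\varphi$ holds at $u_i$; $\mathit{root}$: $v$ is the root; $@_{\mathit{root}}\varphi$: $\varphi$ holds at the root. $T\models\varphi$ means $\varphi$ holds at the root $r$ under the assignment $(r,\dots,r)$. The $\mathrm{HCTL}$-game for $L$: the spoiler picks $k\in\mathbb N$; the duplicator picks trees $T\in L$ and $T'\notin L$; then the $k$-round core game is played. Initially the roots are regarded as selected: $a_0$ = root of $T$, $a'_0$ = root of $T'$. In each round $i=1,\dots,k$ the spoiler chooses a tree and a move type. Node move: the spoiler picks a node in one tree and the duplicator picks a node in the other; call them $a_i$ (in $T$) and $a'_i$ (in $T'$). Path move (say in $T$; symmetric for $T'$): the spoiler picks an already selected node $a_j$ ($j<i$) such that no other selected node $a_l$ ($l<i$) lies below $a_j$, and a path $\pi$ starting at $a_j$; the duplicator picks a path $\pi'$ starting at $a'_j$; then the spoiler picks a node $a'_i$ on $\pi'$ and the duplicator picks a node $a_i$ on $\pi$. The duplicator wins if at the end, for all $i,j$: $a_i$ is the root iff $a'_i$ is; $a_i=a_j$ iff $a'_i=a'_j$; each proposition holds at $a_i$ iff it holds at $a'_i$; there is a downward path from $a_i$ to $a_j$ iff there is one from $a'_i$ to $a'_j$; $a_j$ is a child of $a_i$ iff $a'_j$ is a child of $a'_i$. Otherwise the spoiler wins. *)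

(* Defs.v *)
From mathcomp Require Import all_boot.
From Stdlib Require Import Relations.

Set Implicit Arguments.
Unset Strict Implicit.
Unset Printing Implicit Defensive.

(* Trees of arbitrary branching over an arbitrary type P of propositions.  The
   axioms say that every node is reached from the root in finitely many steps,
   that parents are unique and that the root has no parent. *)
Record tree (P : Type) := Tree {
  node :> Type;
  root : node;
  child : node -> node -> Prop;  (* child v w: there is an edge from v to w *)
  label : node -> P -> Prop;
  tree_reach : forall v, clos_refl_trans node child root v;
  tree_parent : forall v w z, child v z -> child w z -> v = w;
  tree_root : forall v, ~ child v root
}.

Section Trees.
Variables (P : Type) (T : tree P).

Definition leaf (v : T) : Prop := forall w, ~ child v w.

Definition downward (v w : T) : Prop := clos_refl_trans T (@child P T) v w.

(* A finite or infinite sequence of nodes; a finite one is followed by None. *)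
Definition node_seq : Type := nat -> option T.

Definition is_path (v : T) (pi : node_seq) : Prop :=
  pi 0 = Some v /\
  forall n, match pi n, pi n.+1 with
            | Some u, Some w => child u w
            | Some u, None => leaf u
            | None, next => next = None
            end.

Definition on_path (pi : node_seq) (w : T) : Prop := exists n, pi n = Some w.

End Trees.

(* State formulas of HCTL_k; the variables x_1, ..., x_k are indexed by 'I_k. *)
Inductive hctl (P : Type) (k : nat) : Type :=
| Prp of P
| Neg of hctl P k
| Or of hctl P k & hctl P k
| And of hctl P k & hctl P k
| EX of hctl P k
| AX of hctl P k
| EU of hctl P k & hctl P k
| AU of hctl P k & hctl P k
| Down of 'I_k & hctl P k
| Var of 'I_k
| AtVar of 'I_k & hctl P k
| Root
| AtRoot of hctl P k.

Arguments Var {P k}.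
Arguments Root {P k}.

Definition update (k : nat) (A : Type) (u : 'I_k -> A) (i : 'I_k) (v : A) :
  'I_k -> A := fun j => if j == i then v else u j.

Definition until (P : Type) (T : tree P) (S1 S2 : T -> Prop)
    (pi : node_seq T) : Prop :=
  exists j, (exists w, pi j = Some w /\ S2 w) /\
            forall l, l < j -> exists w, pi l = Some w /\ S1 w.

Fixpoint sat (P : Type) (k : nat) (T : tree P) (v : T) (u : 'I_k -> T)
    (phi : hctl P k) {struct phi} : Prop :=
  match phi with
  | Prp p => label v p
  | Neg f => ~ sat v u f
  | Or f g => sat v u f \/ sat v u g
  | And f g => sat v u f /\ sat v u g
  | EX f => exists w, child v w /\ sat w u f
  | AX f => forall w, child v w -> sat w u f
  | EU f g => exists pi, is_path v pi /\
                until (fun w => sat w u f) (fun w => sat w u g) pi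
  | AU f g => forall pi, is_path v pi ->
                until (fun w => sat w u f) (fun w => sat w u g) pi
  | Down i f => sat v (update u i v) f
  | Var i => v = u i
  | AtVar i f => sat (u i) u f
  | Root => v = root T
  | AtRoot f => sat (root T) u f
  end.

Definition models (P : Type) (k : nat) (T : tree P) (phi : hctl P k) : Prop :=
  sat (root T) (fun=> root T) phi.

Definition hctl_characterizable (P : Type) (L : tree P -> Prop) : Prop :=
  exists (k : nat) (phi : hctl P k), forall T, L T <-> models T phi.

Section CoreGame.
Variables (P : Type) (T T' : tree P).

(* The pairs (a_0, a'_0), (a_1, a'_1), ... selected so far, in this order. *)
Definition position : Type := seq (T * T').

Definition selL (s : position) (i : nat) : T := (nth (root T, root T') s i).1.
Definition selR (s : position) (i : nat) : T' := (nth (root T, root T') s i).2.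

Definition duplicator_wins (s : position) : Prop :=
  forall i j, i < size s -> j < size s ->
  [/\ selL s i = root T <-> selR s i = root T',
      selL s i = selL s j <-> selR s i = selR s j,
      forall p, label (selL s i) p <-> label (selR s i) p,
      downward (selL s i) (selL s j) <-> downward (selR s i) (selR s j) &
      child (selL s i) (selL s j) <-> child (selR s i) (selR s j)].

(* Spoiler strategies for n rounds.  The letter L or R says whether the spoiler
   moves in T or in T'; every argument of function type prescribes how the
   spoiler goes on depending on the duplicator's replies.  In a path move, j is
   the index of the selected node where the paths start, and pick gives the
   spoiler's node on the duplicator's path. *)
Inductive strategy : nat -> Type :=
| Stop : strategy 0
| NodeL n (a : T) (cont : T' -> strategy n) : strategy n.+1
| NodeR n (a' : T') (cont : T -> strategy n) : strategy n.+1
| PathL n (j : nat) (pi : node_seq T)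
    (pick : node_seq T' -> T') (cont : node_seq T' -> T -> strategy n) :
    strategy n.+1
| PathR n (j : nat) (pi' : node_seq T')
    (pick : node_seq T -> T) (cont : node_seq T -> T' -> strategy n) :
    strategy n.+1.

(* No selected node other than a_j (resp. a'_j) itself lies below it. *)
Definition lowestL (s : position) (j : nat) : Prop :=
  forall l, l < size s -> selL s l <> selL s j ->
    ~ downward (selL s j) (selL s l).
Definition lowestR (s : position) (j : nat) : Prop :=
  forall l, l < size s -> selR s l <> selR s j ->
    ~ downward (selR s j) (selR s l).

(* From position s, all moves of the strategy are legal and it wins against
   all legal replies of the duplicator. *)
Fixpoint winning (n : nat) (sigma : strategy n) (s : position) : Prop :=
  match sigma with
  | Stop => ~ duplicator_wins s
  | NodeL _ a cont => forall a', winning (cont a') (rcons s (a, a'))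
  | NodeR _ a' cont => forall a, winning (cont a) (rcons s (a, a'))
  | PathL _ j pi pick cont =>
      [/\ j < size s, lowestL s j, is_path (selL s j) pi &
       forall pi', is_path (selR s j) pi' ->
         on_path pi' (pick pi') /\
         forall a, on_path pi a ->
           winning (cont pi' a) (rcons s (a, pick pi'))]
  | PathR _ j pi' pick cont =>
      [/\ j < size s, lowestR s j, is_path (selR s j) pi' &
       forall pi, is_path (selL s j) pi ->
         on_path pi (pick pi) /\
         forall a', on_path pi' a' ->
           winning (cont pi a') (rcons s (pick pi, a'))]
  end.

End CoreGame.

Definition spoiler_has_winning_strategy (P : Type) (L : tree P -> Prop) :
    Prop :=
  exists (k : nat) (sigma : forall T T' : tree P, strategy T T' k),
    forall T T', L T -> ~ L T' ->
      winning (sigma T T') [:: (root T, root T')].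

(* Main.v *)
(* By induction on the formula, the spoiler wins from every position whose
   selected nodes include the arguments of a formula true in one tree and false
   in the other.  Since a node determines the path leading down to it,
   [E (f U g)] needs only node moves.  If [A (f U g)] fails at [v'] because [f]
   fails at some node below [v'] before [g] has held, then that node, possibly
   followed by one node above the reply, suffices.  Otherwise [g] fails on a
   whole path from [v'], where a path move need not be legal yet.  But only
   finitely many nodes are selected, so far enough down this path there is a
   node [w'] with no other selected node below it: the spoiler first selects
   [w'] and then plays the rest of the path from there. *)

From mathcomp Require Import all_boot.
From Stdlib Require Import Relations Classical ClassicalEpsilon.
Require Import Defs.

Set Implicit Arguments.
Unset Strict Implicit.
Unset Printing Implicit Defensive.

(** * The descendant order of a tree and its maximal paths *)

Section TreeOrder.
Variables (P : Type) (T : tree P).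
Implicit Types v w z x y : T.

Lemma downward_refl v : downward v v.
Proof. exact: rt_refl. Qed.

Lemma downward_trans v w z : downward v w -> downward w z -> downward v z.
Proof. exact: rt_trans. Qed.

Lemma child_downward v w : child v w -> downward v w.
Proof. exact: rt_step. Qed.

Lemma downward_last v w :
  downward v w -> v = w \/ exists2 z, downward v z & child z w.
Proof.
move=> vw; case: (clos_rt_rtn1 _ _ _ _ vw) => [|z y zy vz]; first by left.
by right; exists z => //; apply: clos_rtn1_rt.
Qed.

Lemma downward_child v w z : downward v w -> child z w -> v = w \/ downward v z.
Proof.
case/downward_last=> [->|[y vy yw] zw]; first by left.
by right; rewrite (tree_parent zw yw).
Qed.

Lemma downward_root v : downward v (root T) -> v = root T.
Proof. by case/downward_last=> // -[z _ /tree_root]. Qed.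

Lemma root_ind (Q : T -> Prop) :
  Q (root T) -> (forall v w, child v w -> Q v -> Q w) -> forall v, Q v.
Proof.
move=> Q0 QS v; elim: (clos_rt_rtn1 _ _ _ _ (tree_reach v)) => // w z wz _.
exact: QS wz.
Qed.

(** A cycle through a node also passes through its unique parent, hence climbs up to the root, which
    has no parent. *)
Lemma acyclic v w : child v w -> ~ downward w v.
Proof.
move: v w; apply: root_ind => [w cw /downward_root ew|v y vy IH w yw wy].
  by rewrite ew in cw; case: (tree_root cw).
case: (downward_child wy vy) => [ewy|wv].
  rewrite ewy in yw; have evy := tree_parent vy yw.
  by rewrite evy in IH; apply: (IH y yw); apply: downward_refl.
exact: (IH _ vy) (downward_trans (child_downward yw) wv).
Qed.

Lemma downward_antisym v w : downward v w -> downward w v -> v = w.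
Proof.
move=> vw wv; case: (downward_last vw) => // -[z vz zw].
by case: (acyclic zw); apply: downward_trans wv vz.
Qed.

Section Path.
Variables (v : T) (pi : node_seq T).
Hypothesis pi_path : is_path v pi.

Lemma path_child n w : pi n.+1 = Some w -> exists2 z, pi n = Some z & child z w.
Proof.
move=> e; have := pi_path.2 n; rewrite e.
by case: (pi n) => // z zw; exists z.
Qed.

Lemma path_below n w : pi n = Some w -> downward v w.
Proof.
elim: n w => [|n IH] w.
  by rewrite pi_path.1 => -[<-]; exact: downward_refl.
case/path_child=> z /IH vz zw; apply: downward_trans vz _.
exact: child_downward.
Qed.

Lemma path_le l j w : l <= j -> pi j = Some w ->
  exists2 z, pi l = Some z & downward z w.
Proof.
elim: j w => [|j IH] w.
  by rewrite leqn0 => /eqP -> e; exists w => //; apply: downward_refl.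
rewrite leq_eqVlt => /orP [/eqP -> e|lj].
  by exists w => //; apply: downward_refl.
case/path_child=> y /(IH _ lj) [z ez zy] yw; exists z => //.
by apply: downward_trans zy _; apply: child_downward.
Qed.

Lemma path_lt l j w : l < j -> pi j = Some w ->
  exists z, [/\ pi l = Some z, downward z w & z <> w].
Proof.
case: j => // j; rewrite ltnS => lj /path_child [y /(path_le lj) [z ez zy] yw].
exists z; split=> // [|ezw].
  by apply: downward_trans zy _; apply: child_downward.
by case: (acyclic yw); rewrite -ezw.
Qed.

(** Parents are unique, so climbing from [w] towards [v] retraces the path and meets every node in
    between. *)
Lemma path_between j w z : pi j = Some w -> downward v z -> downward z w ->
  exists2 l, l <= j & pi l = Some z.
Proof.
elim: j w => [|j IH] w e vz zw.
  move: (e); rewrite pi_path.1 => -[ew]; rewrite -ew in zw.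
  by exists 0; rewrite // pi_path.1 (downward_antisym vz zw).
case: (path_child e) => y ey yw.
case: (downward_child zw yw) => [->|zy]; first by exists j.+1.
by case: (IH _ ey vz zy) => l lj ez; exists l => //; apply: leqW.
Qed.

Lemma path_tail n w : pi n = Some w -> is_path w (fun m => pi (n + m)).
Proof.
by move=> e; split=> [|m]; rewrite ?addn0 // addnS; apply: pi_path.2.
Qed.

(* The path visits finitely many proper ancestors of [x]. *)
Lemma path_escape1 x :
  exists n w, pi n = Some w /\ (downward w x -> x = w).
Proof.
move: x; apply: root_ind => [|x y xy [n [w [ew wx]]]].
  by exists 0, v; split=> [|/downward_root //]; apply: pi_path.1.
case: (classic (downward w y -> y = w)) => [|nwy]; first by exists n, w.
have [wy nyw] : downward w y /\ y <> w by tauto.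
(* Now [w] is the parent of [y], so [w] is no leaf and one more step of the path suffices. *)
have exw : x = w by case: (downward_child wy xy) => [ewy|/wx //]; case: nyw.
have := pi_path.2 n; rewrite ew; case en : (pi n.+1) => [z|] => [wz|lw].
  exists n.+1, z; split=> // zy; case: (downward_child zy xy) => // zx.
  by case: (acyclic wz); rewrite -exw.
by case: (lw y); rewrite -exw.
Qed.

(** Each listed node has an index of its own by [path_escape1]; the condition persists further down
    the path, so the largest index serves all of them. *)
Lemma path_escape (A : Type) (f : A -> T) (s : seq A) (d : A) :
  exists n w, pi n = Some w /\
    forall i, i < size s -> downward w (f (nth d s i)) -> f (nth d s i) = w.
Proof.
elim: s => [|x s [n [w [ew ws]]]].
  by exists 0, v; split; first apply: pi_path.1.
have [m [y [ey yx]]] := path_escape1 (f x).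
have step a b p c : pi a = Some b -> pi p = Some c -> a <= p ->
    forall q, (downward b q -> q = b) -> downward c q -> q = c.
  move=> eb ec ap q bq cq; case: (path_le ap ec) => b'; rewrite eb => -[<-] bc.
  have eq := bq (downward_trans bc cq); rewrite eq in cq *.
  exact: downward_antisym.
case/orP: (leq_total m n) => [mn|nm].
  by exists n, w; split=> // -[_|i]; [apply: step ey ew mn _ yx | apply: ws].
exists m, y; split=> // -[_|i lt_i]; first exact: yx.
exact: step ew ey nm _ (ws i lt_i).
Qed.

End Path.

Lemma path_cons v w pi : child v w -> is_path w pi ->
  is_path v (fun n => if n is m.+1 then pi m else Some v).
Proof. by move=> vw [pi0 piS]; split=> // -[|n]; [rewrite /= pi0 | apply: piS]. Qed.

Lemma path_prepend v w pi : downward v w -> is_path w pi ->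
  exists pi' j, is_path v pi' /\ forall n, pi' (j + n) = pi n.
Proof.
move=> vw; elim: (clos_rt_rt1n _ _ _ _ vw) pi => [x|x y z xy _ IH] pi pw.
  by exists pi, 0.
have [pi' [j [py e]]] := IH _ pw.
by eexists; exists j.+1; split; first exact: path_cons xy py.
Qed.

(** Iterating a choice of children, which gives [None] only at a leaf or after the end, yields a
    maximal path. *)
Lemma path_exists v : exists pi, is_path v pi.
Proof.
pose next (o : option T) :=
  if o is Some u then
    if excluded_middle_informative (exists w, child u w) is left e
    then Some (proj1_sig (constructive_indefinite_description _ e)) else None
  else None.
exists (fun n => iter n next (Some v)); split=> // n.
rewrite iterS; case: (iter n next (Some v)) => //= u.
case: excluded_middle_informative => [e|ne]; first exact: proj2_sig.
by move=> w uw; apply: ne; exists w.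
Qed.

Lemma path_through v w : downward v w ->
  exists pi j, is_path v pi /\ pi j = Some w.
Proof.
move=> vw; have [pi pw] := path_exists w.
have [pi' [j [pv e]]] := path_prepend vw pw.
by exists pi', j; split=> //; rewrite -[j]addn0 e pw.1.
Qed.

(** The segment of a path from [v] down to [w] consists of exactly the nodes between them, so the
    quantifier over paths turns into one over nodes. *)
Lemma EU_downward v (S1 S2 : T -> Prop) :
  (exists pi, is_path v pi /\ until S1 S2 pi) <->
  exists w, [/\ downward v w, S2 w &
    forall z, downward v z -> downward z w -> z <> w -> S1 z].
Proof.
split=> [[pi [pv [j [[w [ew Sw]] S1l]]]]|[w [vw Sw S1z]]].
  exists w; split=> // [|z vz zw nzw]; first exact: path_below ew.
  have [l lj ez] := path_between pv ew vz zw.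
  have {}lj : l < j.
    rewrite ltn_neqAle lj andbT; apply/eqP => elj.
    by apply: nzw; move: ez; rewrite elj ew => -[].
  by have [z' []] := S1l _ lj; rewrite ez => -[<-].
have [pi [j [pv ew]]] := path_through vw.
exists pi; split=> //; exists j; split=> [|l lj]; first by exists w.
have [z [ez zw nzw]] := path_lt pv lj ew.
by exists z; split=> //; apply: S1z => //; apply: path_below ez.
Qed.

(** If the second alternative fails, induction on the index excludes [S2] along [pi]: a first node
    with [S2] would have [S1] at every node before it, which makes the until true. *)
Lemma not_until v (S1 S2 : T -> Prop) (pi : node_seq T) :
  is_path v pi -> ~ until S1 S2 pi ->
  (forall w, on_path pi w -> ~ S2 w) \/
  exists w, [/\ downward v w, ~ S1 w &
    forall z, downward v z -> downward z w -> ~ S2 z].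
Proof.
move=> pv nU.
case: (classic (exists w, [/\ downward v w, ~ S1 w &
    forall z, downward v z -> downward z w -> ~ S2 z])) => [|nS]; first by right.
left=> w [n]; elim/ltn_ind: n w => n IH w ew Sw; apply: nU.
exists n; split=> [|l ln]; first by exists w.
have [z [ez _ _]] := path_lt pv ln ew.
exists z; split=> //; apply: NNPP => nSz; apply: nS; exists z.
split=> // [|y vy yz]; first exact: path_below ez.
have [m ml ey] := path_between pv ez vy yz.
exact: IH (leq_ltn_trans ml ln) _ ey.
Qed.

End TreeOrder.

(** * Positions and the existence of winning strategies *)

Section Game.
Variables (P : Type) (T T' : tree P).
Implicit Types s : position T T'.

Definition selected s (a : T) (a' : T') : Prop :=
  exists2 i, i < size s & selL s i = a /\ selR s i = a'.

Lemma selected_last s a a' : selected (rcons s (a, a')) a a'.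
Proof.
exists (size s); first by rewrite size_rcons.
by rewrite /selL /selR nth_rcons ltnn eqxx.
Qed.

Lemma sel_rcons s x i : i < size s ->
  selL (rcons s x) i = selL s i /\ selR (rcons s x) i = selR s i.
Proof. by rewrite /selL /selR nth_rcons => ->. Qed.

Lemma selected_rcons s x a a' : selected s a a' -> selected (rcons s x) a a'.
Proof.
case=> i lt_i e; exists i; first by rewrite size_rcons ltnW.
by have [-> ->] := sel_rcons x lt_i.
Qed.

Lemma duplicator_wins_rcons s x :
  duplicator_wins (rcons s x) -> duplicator_wins s.
Proof.
move=> D i j lt_i lt_j; have := D i j; rewrite size_rcons !ltnS.
move=> /(_ (ltnW lt_i) (ltnW lt_j)).
by have [-> ->] := sel_rcons x lt_i; have [-> ->] := sel_rcons x lt_j.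
Qed.

Lemma duplicator_winsP s a a' b b' : duplicator_wins s ->
  selected s a a' -> selected s b b' ->
  [/\ a = root T <-> a' = root T', a = b <-> a' = b',
      forall p, label a p <-> label a' p,
      downward a b <-> downward a' b' & child a b <-> child a' b'].
Proof. by move=> D [i lt_i [<- <-]] [j lt_j [<- <-]]; apply: D. Qed.

Definition spoiler_wins n s : Prop :=
  exists sigma : strategy T T' n, winning sigma s.

(** Makes legal moves only; it fills the remaining rounds of a game that is already decided and
    shows that strategies exist. *)
Fixpoint idle n : strategy T T' n :=
  if n is m.+1 then NodeL (root T) (fun=> idle m) else Stop T T'.

(** Continuations are functions of the duplicator's replies, so a strategy that is merely known to
    exist has to be chosen for each position. *)
Definition winning_strategy n s : strategy T T' n :=
  epsilon (inhabits (idle n)) (fun sigma => winning sigma s).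

Lemma winning_strategyP n s : spoiler_wins n s -> winning (winning_strategy n s) s.
Proof. exact: epsilon_spec. Qed.

(** A mismatch between selected nodes persists when more pairs are added. *)
Lemma spoiler_wins_lost n s : ~ duplicator_wins s -> spoiler_wins n s.
Proof.
move=> D; exists (idle n); elim: n s D => //= n IH s D a'.
by apply: IH => /duplicator_wins_rcons.
Qed.

(** Lets the later arguments assume that the replies so far preserve all relations checked at the
    end. *)
Lemma spoiler_wins_live n s :
  (duplicator_wins s -> spoiler_wins n s) -> spoiler_wins n s.
Proof.
by move=> W; case: (classic (duplicator_wins s)) => [/W|/spoiler_wins_lost].
Qed.

Lemma node_move n s a :
  (forall a', duplicator_wins (rcons s (a, a')) ->
     spoiler_wins n (rcons s (a, a'))) ->
  spoiler_wins n.+1 s.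
Proof.
move=> W; exists (NodeL a (fun a' => winning_strategy n (rcons s (a, a')))).
by move=> a' /=; apply/winning_strategyP/spoiler_wins_live/W.
Qed.

Lemma path_move n s a a' pi :
  selected s a a' ->
  (forall b b', selected s b b' -> downward a b -> b = a) ->
  is_path a pi ->
  (forall pi', is_path a' pi' -> exists2 b', on_path pi' b' &
     forall b, on_path pi b -> duplicator_wins (rcons s (b, b')) ->
       spoiler_wins n (rcons s (b, b'))) ->
  spoiler_wins n.+1 s.
Proof.
case=> j lt_j [ea ea'] low pa W.
(* The spoiler's node on [pi'] is fixed before the duplicator answers, so it must win against every
   answer [b]. *)
pose good pi' b' := on_path pi' b' /\
  forall b, on_path pi b -> spoiler_wins n (rcons s (b, b')).
pose pick pi' := epsilon (inhabits (root T')) (good pi').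
exists (PathL j pi pick (fun pi' b => winning_strategy n (rcons s (b, pick pi')))).
rewrite /= ea ea'; split=> // [l lt_l nla al|pi' pa'].
  by apply: nla; rewrite ea; apply: (low _ (selR s l)); [exists l | rewrite -ea].
have [on_pick win] : good pi' (pick pi').
  apply: epsilon_spec; have [b' pb' Wb'] := W _ pa'.
  by exists b'; split=> // b pb; apply/spoiler_wins_live/Wb'.
by split=> // b pb; apply/winning_strategyP/win.
Qed.

(** The arguments of a formula in the two trees are matched by selected pairs; the pair of roots is
    carried along for [AtRoot]. *)
Definition linked k s (v : T) (v' : T') (u : 'I_k -> T) (u' : 'I_k -> T') : Prop :=
  [/\ selected s (root T) (root T'), selected s v v' &
      forall i, selected s (u i) (u' i)].

Lemma linked_rcons k s x v v' (u : 'I_k -> T) u' :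
  linked s v v' u u' -> linked (rcons s x) v v' u u'.
Proof. by case=> r v0 u0; split=> [||i]; apply: selected_rcons. Qed.

Lemma linked_move k s v v' w w' (u : 'I_k -> T) u' :
  selected s w w' -> linked s v v' u u' -> linked s w w' u u'.
Proof. by move=> sw []. Qed.

End Game.

(** * Exchange of the two trees *)

Section Mirror.
Variables (P : Type).

(** Swapping the trees turns each move into the same move on the other side; this yields the moves
    in [T'] from those in [T] and later treats negation. *)
Fixpoint mirror_strategy (T T' : tree P) n (sigma : strategy T T' n) :
    strategy T' T n :=
  match sigma with
  | Stop => Stop T' T
  | NodeL _ a cont => NodeR a (fun a' => mirror_strategy (cont a'))
  | NodeR _ a' cont => NodeL a' (fun a => mirror_strategy (cont a))
  | PathL _ j pi pick cont =>
      PathR j pi pick (fun pi' a => mirror_strategy (cont pi' a))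
  | PathR _ j pi' pick cont =>
      PathL j pi' pick (fun pi a' => mirror_strategy (cont pi a'))
  end.

Lemma sel_mirror (T T' : tree P) (s : position T T') i :
  selL (map swap_pair s) i = selR s i /\
  selR (map swap_pair s) i = selL s i.
Proof.
rewrite /selL /selR; case: (ltnP i (size s)) => lt_i.
  by rewrite !(nth_map (root T, root T')).
by rewrite !nth_default ?size_map.
Qed.

Lemma selected_mirror (T T' : tree P) (s : position T T') a a' :
  selected s a a' -> selected (map swap_pair s) a' a.
Proof.
case=> i lt_i [<- <-]; exists i; first by rewrite size_map.
by have [-> ->] := sel_mirror s i.
Qed.

Lemma linked_mirror (T T' : tree P) k (s : position T T') v v' (u : 'I_k -> T) u' :
  linked s v v' u u' -> linked (map swap_pair s) v' v u' u.
Proof. by case=> r v0 u0; split=> [||i]; apply: selected_mirror. Qed.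

Lemma duplicator_wins_mirror (T T' : tree P) (s : position T T') :
  duplicator_wins (map swap_pair s) -> duplicator_wins s.
Proof.
move=> D i j lt_i lt_j; have := D i j; rewrite size_map => /(_ lt_i lt_j).
have [-> ->] := sel_mirror s i; have [-> ->] := sel_mirror s j.
by case=> ? ? lab ? ?; split=> [||p||]; rewrite ?lab; tauto.
Qed.

Lemma winning_mirror (T T' : tree P) n (sigma : strategy T T' n) s :
  winning sigma s -> winning (mirror_strategy sigma) (map swap_pair s).
Proof.
elim: sigma s => [|m a cont IH|m a cont IH|
  m j pi pick cont IH|m j pi pick cont IH] s /=.
- by move=> nD /duplicator_wins_mirror.
- by move=> W a'; rewrite -(map_rcons _ s (a, a')); apply: IH.
- by move=> W a'; rewrite -(map_rcons _ s (a', a)); apply: IH.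
- case=> lt_j low pj W; rewrite size_map; have [-> ->] := sel_mirror s j.
  split=> // [l|pi' pj']; last first.
    have [on_pick Wa] := W _ pj'; split=> // a pa.
    by rewrite -(map_rcons _ s (a, _)); apply/IH/Wa.
  by have := low l; rewrite /lowestR size_map; have [_ ->] := sel_mirror s l;
    have [_ ->] := sel_mirror s j.
- case=> lt_j low pj W; rewrite size_map; have [-> ->] := sel_mirror s j.
  split=> // [l|pi' pj']; last first.
    have [on_pick Wa] := W _ pj'; split=> // a pa.
    by rewrite -(map_rcons _ s (_, a)); apply/IH/Wa.
  by have := low l; rewrite /lowestL size_map; have [-> _] := sel_mirror s l;
    have [-> _] := sel_mirror s j.
Qed.

Lemma spoiler_wins_mirror (T T' : tree P) n (s : position T T') :
  spoiler_wins n (map swap_pair s) -> spoiler_wins n s.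
Proof.
case=> sigma /winning_mirror; rewrite (mapK swap_pairK) => W.
by exists (mirror_strategy sigma).
Qed.

Variables T T' : tree P.
Implicit Type s : position T T'.

Lemma node_moveR n s a' :
  (forall a, duplicator_wins (rcons s (a, a')) ->
     spoiler_wins n (rcons s (a, a'))) ->
  spoiler_wins n.+1 s.
Proof.
move=> W; apply: spoiler_wins_mirror; apply: (node_move (a := a')) => a _.
rewrite -(map_rcons _ s (a, a')); apply: spoiler_wins_mirror.
by rewrite (mapK swap_pairK); apply/spoiler_wins_live/W.
Qed.

Lemma path_moveR n s a a' pi' :
  selected s a a' ->
  (forall b b', selected s b b' -> downward a' b' -> b' = a') ->
  is_path a' pi' ->
  (forall pi, is_path a pi -> exists2 b, on_path pi b &
     forall b', on_path pi' b' -> duplicator_wins (rcons s (b, b')) ->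
       spoiler_wins n (rcons s (b, b'))) ->
  spoiler_wins n.+1 s.
Proof.
move=> sa low pa W; apply: spoiler_wins_mirror.
apply: (path_move (selected_mirror sa) _ pa) => [b' b /selected_mirror|pi /W].
  by rewrite (mapK swap_pairK); apply: low.
case=> b pb Wb; exists b => // b' pb' _.
rewrite -(map_rcons _ s (b, b')); apply: spoiler_wins_mirror.
by rewrite (mapK swap_pairK); apply/spoiler_wins_live/Wb.
Qed.

End Mirror.

(** * Winning strategies from distinguishing formulas *)

Fixpoint rounds P k (phi : hctl P k) : nat :=
  match phi with
  | Prp _ | Var _ | Root => 0
  | Neg f | Down _ f | AtVar _ f | AtRoot f => rounds f
  | Or f g | And f g => maxn (rounds f) (rounds g)
  | EX f | AX f => (rounds f).+1
  (* An until takes up to two moves: a node move, then a second node move or a path move. *)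
  | EU f g | AU f g => (maxn (rounds f) (rounds g)).+2
  end.

Definition separating P k (phi : hctl P k) : Prop :=
  forall (T T' : tree P) n (s : position T T') v v' u u',
  rounds phi <= n -> linked s v v' u u' ->
  sat v u phi -> ~ sat v' u' phi -> spoiler_wins n s.

Section Until.
Variables (P : Type) (k : nat) (f g : hctl P k).
Hypotheses (sep_f : separating f) (sep_g : separating g).

(** The spoiler selects the node [w] where [g] holds. If [g] holds at the reply [w'] too, then [f]
    fails at some [z'] from [v'] down to but excluding [w']; the spoiler selects [z'], and the reply
    lies strictly above [w], where [f] holds. *)
Lemma separating_EU : separating (EU f g).
Proof.
move=> T T' [|[|n]] s v v' u u' //; rewrite !ltnS geq_max => /andP [fn gn] lk.
case/EU_downward=> w [vw gw fz] /EU_downward nEU.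
apply: (node_move (a := w)) => w' D.
have lk1 := linked_rcons (w, w') lk; have sw := selected_last s w w'.
have [_ _ _ [vw' _] _] : _ := duplicator_winsP D (let: And3 _ h _ := lk1 in h) sw.
case: (classic (sat w' u' g)) => [gw'|]; last first.
  by apply: sep_g gw; [apply: leqW | apply: linked_move lk1].
have [z' [vz' zw' nzw' nfz']] : exists z', [/\ downward v' z', downward z' w',
    z' <> w' & ~ sat z' u' f].
  apply: NNPP => nz'; apply: nEU; exists w'; split=> //; first exact: vw'.
  move=> z' vz' zw' nzw'; apply: NNPP => nfz'; apply: nz'.
  by exists z'.
apply: (node_moveR (a' := z')) => z D2.
have lk2 := linked_rcons (z, z') lk1.
have sz := selected_last (rcons s (w, w')) z z'.
have sw2 := selected_rcons (z, z') sw.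
have [_ _ _ [_ vz] _] := duplicator_winsP D2 (let: And3 _ h _ := lk2 in h) sz.
have [_ [ezw _] _ [_ zw] _] := duplicator_winsP D2 sz sw2.
apply: sep_f nfz' => //; first exact: linked_move sz lk2.
by apply: fz; [apply: vz | apply: zw | move=> /ezw].
Qed.

Lemma separating_AU : separating (AU f g).
Proof.
move=> T T' [|[|n]] s v v' u u' //; rewrite !ltnS geq_max => /andP [fn gn] lk AUv nAU.
have [pi' [pv' nU]] : exists pi', is_path v' pi' /\
    ~ until (fun w => sat w u' f) (fun w => sat w u' g) pi'.
  by apply: NNPP => npi'; apply: nAU => pi' pv'; apply: NNPP => nU; apply: npi'; exists pi'.
(* If [g] holds somewhere between [v] and [w] but nowhere between [v'] and [w'], selecting such a
   node forces a reply where [g] fails. *)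
have between w w' z : duplicator_wins (rcons s (w, w')) ->
    (forall z', downward v' z' -> downward z' w' -> ~ sat z' u' g) ->
    downward v z -> downward z w -> sat z u g ->
    spoiler_wins n.+1 (rcons s (w, w')).
  move=> D ng vz zw gz; apply: (node_move (a := z)) => z' D2.
  have lk2 := linked_rcons (z, z') (linked_rcons (w, w') lk).
  have sz := selected_last (rcons s (w, w')) z z'.
  have sw := selected_rcons (z, z') (selected_last s w w').
  have [_ _ _ [vz' _] _] := duplicator_winsP D2 (let: And3 _ h _ := lk2 in h) sz.
  have [_ _ _ [zw' _] _] := duplicator_winsP D2 sz sw.
  apply: sep_g gz _ => //; first exact: linked_move sz lk2.
  by apply: ng; [apply: vz' | apply: zw'].
case: (not_until pv' nU) => [ng|[w' [vw' nfw' ng]]]; last first.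
  apply: (node_moveR (a' := w')) => w D.
  have lk1 := linked_rcons (w, w') lk; have sw := selected_last s w w'.
  have [_ _ _ [_ vw] _] := duplicator_winsP D (let: And3 _ h _ := lk1 in h) sw.
  have {}vw := vw vw'; have [pi [j [pv ew]]] := path_through vw.
  have [l [[z [ez gz]] fl]] := AUv _ pv.
  (* If the witness for [g] comes after [w], then [f] holds at [w] but fails at [w']; otherwise [g]
     holds at a node between [v] and [w]. *)
  case: (ltnP j l) => [jl|lj].
    have [y [ey fy]] := fl _ jl; move: ey; rewrite ew => -[ey]; rewrite -ey in fy.
    by apply: sep_f fy nfw'; [apply: leqW | apply: linked_move lk1].
  apply: between D ng _ _ gz; first exact: path_below ez.
  by have [y] := path_le pv lj ew; rewrite ez => -[<-].
(* The escape is from the nodes already selected in [T']; the node move then adds only [w'] itself,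
   so a path move from [w'] is legal afterwards. *)
have [m [w' [ew' low]]] := path_escape pv' (fun x : T * T' => x.2) s (root T, root T').
apply: (node_moveR (a' := w')) => w D.
have lk1 := linked_rcons (w, w') lk; have sw := selected_last s w w'.
have [_ _ _ [_ vw] _] := duplicator_winsP D (let: And3 _ h _ := lk1 in h) sw.
have {}vw := vw (path_below pv' ew').
case: (classic (exists z, [/\ downward v z, downward z w & sat z u g])).
  case=> z [vz zw gz]; apply: between D _ vz zw gz => z' vz' zw'.
  by have [l _ ez'] := path_between pv' ew' vz' zw'; apply: ng; exists l.
move=> nz; apply: (path_moveR sw _ (path_tail pv' ew')) => [b b' [i]|pi pw].
  rewrite size_rcons ltnS leq_eqVlt => /orP [/eqP ->|lt_i].
    by rewrite /selR nth_rcons ltnn eqxx => -[_ <-].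
  by have [_ ->] := sel_rcons (w, w') lt_i; case=> _ <-; apply: low.
(* Prefixed by the way from [v] to [w], the duplicator's [pi] becomes a path from [v]. By [nz] its
   node [z] with [g] comes after [w], hence on [pi] at index [l - j], whereas [g] fails at every
   answer on [pi']. *)
have [pi1 [j [pv e]]] := path_prepend vw pw.
have [l [[z [ez gz]] _]] := AUv _ pv.
case: (leqP l j) => [lj|/ltnW jl].
  have e1 : pi1 j = Some w by rewrite -[j]addn0 e pw.1.
  have [y] := path_le pv lj e1; rewrite ez => -[<-] zw.
  by case: nz; exists z; split=> //; apply: path_below ez.
exists z; first by exists (l - j); rewrite -e subnKC.
move=> z' [i ez'] _; apply: sep_g gz _ => //.
  exact: linked_move (selected_last _ z z') (linked_rcons (z, z') lk1).
by apply: ng; exists (m + i).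
Qed.

End Until.

Lemma separatingP P k (phi : hctl P k) : separating phi.
Proof.
elim: phi => [p|f IH|f IHf g IHg|f IHf g IHg|f IH|f IH|f IHf g IHg|
  f IHf g IHg|i f IH|i|i f IH||f IH];
  try by [apply: separating_EU | apply: separating_AU].
all: move=> T T' n s v v' u u' /= le_n lk.
- move=> vp nvp; apply: spoiler_wins_lost => D; apply: nvp.
  by case: lk => _ sv _; have [_ _ <-] := duplicator_winsP D sv sv.
(* Negation exchanges the trees: [f] holds at [v'] and fails at [v]. *)
- move=> nf nnf; apply: spoiler_wins_mirror.
  by apply: IH le_n (linked_mirror lk) _ nf; apply: NNPP.
- move: le_n; rewrite geq_max => /andP [fn gn].
  by case=> sv nor; [apply: (IHf _ _ _ _ _ _ _ _ fn lk sv)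
    | apply: (IHg _ _ _ _ _ _ _ _ gn lk sv)] => sv'; apply: nor; [left | right].
- move: le_n; rewrite geq_max => /andP [fn gn] [fv gv] nand.
  case: (classic (sat v' u' f)) => [fv'|]; last exact: IHf fn lk fv.
  by apply: IHg gn lk gv _ => gv'; apply: nand.
- case: n le_n => // n le_n [w [vw fw]] nEX.
  apply: (node_move (a := w)) => w' D.
  have lk1 := linked_rcons (w, w') lk; have sw := selected_last s w w'.
  have [_ _ _ _ [vw' _]] := duplicator_winsP D (let: And3 _ h _ := lk1 in h) sw.
  apply: IH le_n (linked_move sw lk1) fw _ => fw'.
  by apply: nEX; exists w'; split=> //; apply: vw'.
- case: n le_n => // n le_n AXv nAX.
  have [w' [vw' nfw']] : exists w', child v' w' /\ ~ sat w' u' f.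
    by apply: NNPP => nw'; apply: nAX => w' vw'; apply: NNPP => nf; apply: nw'; exists w'.
  apply: (node_moveR (a' := w')) => w D.
  have lk1 := linked_rcons (w, w') lk; have sw := selected_last s w w'.
  have [_ _ _ _ [_ vw]] := duplicator_winsP D (let: And3 _ h _ := lk1 in h) sw.
  by apply: IH le_n (linked_move sw lk1) _ nfw'; apply: AXv; apply: vw.
(* Binding a variable to the current node costs no round, since that node is selected already. *)
- apply: IH le_n _; case: lk => r sv su; split=> // j.
  by rewrite /update; case: ifP.
- case: lk => _ sv su evu nevu; apply: spoiler_wins_lost => D; apply: nevu.
  by have [_ [h _] _ _ _] := duplicator_winsP D sv (su i); apply: h.
- by apply: IH le_n _; case: lk => r sv su; split.
- case: lk => _ sv _ ev nev; apply: spoiler_wins_lost => D; apply: nev.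
  by have [[h _] _ _ _ _] := duplicator_winsP D sv sv; apply: h.
- by apply: IH le_n _; case: lk.
Qed.

Theorem theorem3 (P : Type) (L : tree P -> Prop) :
  hctl_characterizable L -> spoiler_has_winning_strategy L.
Proof.
(* The number of rounds depends on [phi] alone, so it can be fixed before the trees are known. *)
case=> k [phi Lphi]; exists (rounds phi).
exists (fun T T' => winning_strategy (rounds phi) [:: (root T, root T')]).
move=> T T' /Lphi sat_phi nLT'; apply: winning_strategyP.
have sr : selected [:: (root T, root T')] (root T) (root T') by exists 0.
apply: (separatingP (leqnn _) _ sat_phi
  (v' := root T') (u' := fun=> root T')); first by split.
by move=> /Lphi.
Qed.
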